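(* Let $X$ be a Hausdorff uniform space with uniformity $\mathcal{U}$. If $X$ has property (P) and no isolated point, then every topologically stable homeomorphism $h:X\to X$ has the finite shadowing property and the strict periodic shadowing property.
   Context: Property (P): for each $V\in\mathcal{U}$ there exists $U\in\mathcal{U}$ such that for any integer $k\ge1$, any pairwise distinct points $a_1,\dots,a_k\in X$ and any pairwise distinct points $b_1,\dots,b_k\in X$ with $(a_j,b_j)\in U$ for all $j\in\{1,\dots,k\}$, there is a homeomorphism $f:X\to X$ such that $f(a_j)=b_j$ for all $j\in\{1,\dots,k\}$ and $(x,f(x))\in V$ for all $x\in X$. A homeomorphism $h:X\to X$ is topologically stable if for every $V\in\mathcal{U}$ there exists $U\in\mathcal{U}$ such that for any homeomorphism $g:X\to X$ with $(h(x),g(x))\in U$ for all $x\in X$, there is a continuous map $\phi:X\to X$ with $h\circ\phi=\phi\circ g$ and $(x,\phi(x))\in V$ for all $x\in X$. For $U\in\mathcal{U}$ and a continuous map $f:X\to X$, a finite sequence $(x_j)_{j=0}^k$ ($k\ge1$) in $X$ is a $U$-chain for $f$ if $(f(x_j),x_{j+1})\in U$ for all $j\in\{0,\dots,k-1\}$; it is a $U$-cycle for $f$ if in addition $x_k=x_0$. The map $f$ has the finite shadowing property (resp. the strict periodic shadowing property) if for every $V\in\mathcal{U}$ there exists $U\in\mathcal{U}$ such that for any $U$-chain (resp. $U$-cycle) $(x_j)_{j=0}^k$ for $f$ there exists $a\in X$ with $(x_j,f^j(a))\in V$ for all $j\in\{0,\dots,k\}$ (resp. and $f^k(a)=a$).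 *)

(* Defs.v *)
From mathcomp Require Import all_boot.
From mathcomp Require Import all_classical topology.

Set Implicit Arguments.
Unset Strict Implicit.
Unset Printing Implicit Defensive.

Local Open Scope classical_set_scope.

Definition homeomorphism (T : topologicalType) (f : T -> T) : Prop :=
  continuous f /\
  exists g : T -> T, [/\ continuous g, cancel f g & cancel g f].

Section UniformDynamics.
Variable X : uniformType.

Definition property_P : Prop :=
  forall V : set (X * X), entourage V ->
  exists2 U : set (X * X), entourage U &
    forall (k : nat) (a b : 'I_k -> X),
      (1 <= k)%N -> injective a -> injective b ->
      (forall j, U (a j, b j)) ->
      exists f : X -> X,
        [/\ homeomorphism f,
            forall j, f (a j) = b j &
            forall x, V (x, f x)].

Definition topologically_stable (h : X -> X) : Prop :=
  forall V : set (X * X), entourage V ->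
  exists2 U : set (X * X), entourage U &
    forall g : X -> X, homeomorphism g -> (forall x, U (h x, g x)) ->
      exists phi : X -> X,
        [/\ continuous phi,
            h \o phi = phi \o g &
            forall x, V (x, phi x)].

(* A finite sequence (x_0, ..., x_k) is a function on 'I_k.+1; for j : 'I_k,
   the indices of x_j and x_{j+1} are widen_ord (leqnSn k) j and lift ord0 j. *)
Definition is_chain (U : set (X * X)) (f : X -> X) (k : nat)
    (x : 'I_k.+1 -> X) : Prop :=
  (1 <= k)%N /\
  forall j : 'I_k, U (f (x (widen_ord (leqnSn k) j)), x (lift ord0 j)).

Definition is_cycle (U : set (X * X)) (f : X -> X) (k : nat)
    (x : 'I_k.+1 -> X) : Prop :=
  is_chain U f x /\ x ord_max = x ord0.

Definition finite_shadowing (f : X -> X) : Prop :=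
  forall V : set (X * X), entourage V ->
  exists2 U : set (X * X), entourage U &
    forall (k : nat) (x : 'I_k.+1 -> X), is_chain U f x ->
      exists a : X, forall j : 'I_k.+1, V (x j, iter j f a).

Definition strict_periodic_shadowing (f : X -> X) : Prop :=
  forall V : set (X * X), entourage V ->
  exists2 U : set (X * X), entourage U &
    forall (k : nat) (x : 'I_k.+1 -> X), is_cycle U f x ->
      exists a : X,
        (forall j : 'I_k.+1, V (x j, iter j f a)) /\ iter k f a = a.

End UniformDynamics.

Arguments property_P X : clear implicits.

(* Main.v *)
Require Import Defs.
From mathcomp Require Import all_boot.
From mathcomp Require Import all_classical topology.

(** Perturb the chain [x_0, ..., x_k] to a chain [z] with pairwise distinct
    points (there are no isolated points, and only continuity of [h] at the
    finitely many [x_j] is needed), keeping [z_k = z_0] for a cycle.  Property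
    (P) gives a small homeomorphism [f] with [f (h z_j) = z_(j+1)], so that [z]
    is an orbit of [g = f \o h].  If [h \o phi = phi \o g] with [phi] close to
    the identity, then [phi z_0] is a shadowing point. *)

Local Open Scope classical_set_scope.

(** In a T1 space, deleting the other points of a finite neighbourhood of [x] leaves a
    neighbourhood, so [x] would be isolated. *)
Lemma nbhs_infinite {T : topologicalType} (x : T) (U : set T) :
  accessible_space T -> isolated [set: T] = set0 -> nbhs x U -> infinite_set U.
Proof.
move=> T1 noiso Ux finU.
suff : isolated [set: T] x by rewrite noiso.
split; first by rewrite inE.
exists (U `&` ~` (U `\ x)).
  apply: filterI => //; apply: open_nbhs_nbhs; split; last by case=> _; apply.
  rewrite openC; apply: (accessible_finite_set_closed.1 T1).
  exact: finite_setD.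
apply/seteqP; split=> [y [[Uy nUy] _]|y ->].
  by apply: contrapT => yx; apply: nUy.
by split=> //; split; [exact: nbhs_singleton|case=> _; apply].
Qed.

(** Greedy choice: an infinite set has a point outside any finite list of earlier choices. *)
Lemma injective_selection {T : eqType} (N : nat -> set T) :
  (forall n, infinite_set (N n)) ->
  exists2 y : nat -> T, injective y & forall n, N n (y n).
Proof.
move=> Ninf.
have /choice[c cP] : forall p : seq T * nat, exists t, N p.2 t /\ t \notin p.1.
  move=> [s n] /=; apply: contrapT => noc; apply: (Ninf n).
  apply: sub_finite_set (finite_seq s) => t Nt /=.
  by apply: contrapT => /negP ts; apply: noc; exists t.
(* [s n] lists the points chosen at the stages before [n]. *)
pose s := fix s n := if n is m.+1 then c (s m, m) :: s m else [::].
have mem_s m n : m < n -> c (s m, m) \in s n.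
  elim: n => // n IH; rewrite ltnS leq_eqVlt => /predU1P[->|/IH mn] /=.
    exact: mem_head.
  by rewrite in_cons mn orbT.
have lt_neq m n : m < n -> c (s m, m) <> c (s n, n).
  by move=> /mem_s + e; rewrite e; apply/negP; case: (cP (s n, n)).
exists (fun n => c (s n, n)) => [m n eq_mn|n]; last by case: (cP (s n, n)).
by case: (ltngtP m n) => // /lt_neq; rewrite eq_mn.
Qed.

(** The index map [r] prescribes which points of the perturbed sequence are
    identified: it is the identity for chains, and [j |-> j %% k] for cycles. *)
Lemma pseudo_orbit_shadowing {X : uniformType} {h : X -> X} {V : set (X * X)} :
  hausdorff_space X -> property_P X -> isolated [set: X] = set0 ->
  homeomorphism h -> topologically_stable h -> entourage V ->
  exists2 U : set (X * X), entourage U &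
    forall (r : nat -> nat) (k : nat) (x : nat -> X), 0 < k ->
      {in gtn k &, injective r} -> {in gtn k &, injective (r \o succn)} ->
      (forall j, j <= k -> x (r j) = x j) ->
      (forall j, j < k -> U (h (x j), x j.+1)) ->
      exists a, (forall j, j <= k -> V (x j, iter j h a)) /\
                (r k = r 0 -> iter k h a = a).
Proof.
move=> hausX PX noiso [hcont [h' [h'cont hK h'K]]] stabh entV.
have [W entW stabW] := stabh _ (entourage_split_ent entV).
have [U' entU' PU'] := PX _ entW.
(* From [h z_j] via [h x_j] and [x_(j+1)] to [z_(j+1)]: half of [U'] for the first step, a quarter
   for each of the other two. *)
pose U := split_ent (split_ent U').
have entU : entourage U by do 2!apply: entourage_split_ent.
exists U => // r k x k_gt0 rinj rSinj xr chain.
pose N n := xsection (split_ent V `&` U) (x n) `&`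
  h @^-1` xsection (split_ent U')^-1%relation (h (x n)).
have [n|y yinj Ny] := @injective_selection _ N.
  apply: (@nbhs_infinite _ (x n)) => //; first exact: hausdorff_accessible.
  apply: filterI; first by apply: nbhs_entourage; apply: filterI.
  by apply: hcont; apply: nbhs_entourage; apply: entourage_inv.
pose z j := y (r j).
have zP j : j <= k -> [/\ split_ent V (x j, z j), U (x j, z j) &
    split_ent U' (h (z j), h (x j))].
  move=> jk; have [/xsectionP[VN UN] /xsectionP hN] := Ny (r j).
  by rewrite xr in VN UN hN.
(* Sources use indices [0..k-1], targets [1..k]; [r] is injective on each range separately, so
   [z_k = z_0] is allowed. *)
have [|i j|i j|j|f [[fcont [f' [f'cont fK f'K]]] fz fW]] :=
    PU' k (fun j => h (z j)) (fun j => z j.+1).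
- exact: k_gt0.
- by move=> /(can_inj hK)/yinj/rinj ij; apply/val_inj/ij; exact: ltn_ord.
- by move=> /yinj/rSinj ij; apply/val_inj/ij; exact: ltn_ord.
- have [_ _ hz] := zP j (ltnW (ltn_ord j)).
  have [_ Uz _] := zP j.+1 (ltn_ord j).
  apply: (entourage_split (h (x j))) => //.
  by apply: (entourage_split (x j.+1)) => //; apply: chain.
have [||phi [_ hphi phiV]] := stabW (f \o h).
- split; first by move=> t; apply: continuous_comp; [exact: hcont|exact: fcont].
  exists (h' \o f'); split; [|exact: can_comp|exact: can_comp].
  by move=> t; apply: continuous_comp; [exact: f'cont|exact: h'cont].
- by move=> t; exact: fW.
(* [phi] sends the [f \o h]-orbit [z] to an [h]-orbit, which closes up when [z_k = z_0]. *)
have orbit j : j <= k -> iter j h (phi (z 0)) = phi (z j).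
  elim: j => // j IH jk; rewrite iterS IH; last exact: ltnW.
  by rewrite -[LHS]/((h \o phi) (z j)) hphi /= (fz (Ordinal jk)).
exists (phi (z 0)); split=> [j jk|rk]; last by rewrite orbit // /z rk.
by rewrite orbit //; apply: (entourage_split (z j)) => //; case: (zP j jk).
Qed.

Lemma is_chain_inord {X : uniformType} {U : set (X * X)} {h : X -> X} {k : nat}
    {x : 'I_k.+1 -> X} : is_chain U h x ->
  forall j, j < k -> U (h (x (inord j)), x (inord j.+1)).
Proof.
move=> [_ chain] j jk; have := chain (Ordinal jk).
congr (U (h (x _), x _)); apply: val_inj; rewrite /= inordK //.
exact: leqW.
Qed.

Theorem theorem23 (X : uniformType) (hausX : hausdorff_space X)
    (PX : property_P X) (noiso : isolated [set: X] = set0)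
    (h : X -> X) (homeoh : homeomorphism h) (stabh : topologically_stable h) :
  finite_shadowing h /\ strict_periodic_shadowing h.
Proof.
split=> V entV; have [U entU shadow] :=
    pseudo_orbit_shadowing hausX PX noiso homeoh stabh entV; exists U => // k x.
- move=> chain; have [k_gt0 _] := chain.
  have [||//||a [aV _]] := shadow id k (fun j => x (inord j)) k_gt0.
  + by move=> i j _ _.
  + by move=> i j _ _ [].
  + exact: is_chain_inord chain.
  by exists a => j; rewrite -{1}[j]inord_val; apply: aV; rewrite -ltnS.
- move=> [chain x0k]; have [k_gt0 _] := chain.
  (* Reduction mod [k] replaces only index [k], by [0]; this is harmless since [x_k = x_0]. *)
  have [||j||a [aV ak]] := shadow (modn^~ k) k (fun j => x (inord j)) k_gt0.
  + by move=> i j ik jk; rewrite !modn_small.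
  (* Cancel the common summand 1 modulo [k]. *)
  + move=> i j ik jk /= /eqP; rewrite -[i.+1]add1n -[j.+1]add1n eqn_modDl => /eqP.
    by rewrite !modn_small.
  + rewrite leq_eqVlt => /predU1P[->|jk]; last by rewrite modn_small.
    rewrite modnn (_ : inord 0 = ord0) -?x0k;
      last by apply: val_inj; rewrite /= inordK.
    by congr x; apply: val_inj; rewrite /= inordK.
  + exact: is_chain_inord chain.
  exists a; split; last by apply: ak; rewrite modnn mod0n.
  by move=> j; rewrite -{1}[j]inord_val; apply: aV; rewrite -ltnS.
Qed.
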